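(* Let $n,p\ge 1$ and $s\ge 0$ be integers, let $\mathcal{S}_1,\ldots,\mathcal{S}_p$ be spheres in $\mathbb{R}^n$ (with arbitrary centers and radii), and let $V=\bigcup_{i=1}^p\mathcal{S}_i$. Let $\mathcal{A}\subseteq V$ be an $s$-distance set. Then $$|\mathcal{A}|\leq \sum_{i=0}^{2p-1}\binom{n+s-i-1}{s-i}.$$
   Context: For $\mathcal{A}\subseteq\mathbb{R}^n$, let $d(\mathcal{A})=\{d(p_1,p_2): p_1,p_2\in\mathcal{A},\ p_1\neq p_2\}$ be the set of non-zero Euclidean distances among points of $\mathcal{A}$. The set $\mathcal{A}$ is an $s$-distance set if $|d(\mathcal{A})|\le s$. A sphere in $\mathbb{R}^n$ with center $a$ and radius $r$ is the set $\{x\in\mathbb{R}^n:\sum_{m=1}^n(x_m-a_m)^2=r^2\}$. Binomial coefficients $\binom{a}{b}$ with $b<0$ are understood to be $0$. *)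

(* Defs.v *)
From mathcomp Require Import all_boot all_order all_algebra.
From mathcomp Require Import all_classical all_reals.
Set Implicit Arguments.
Unset Strict Implicit.
Unset Printing Implicit Defensive.
Import Order.TTheory GRing.Theory Num.Theory.
Local Open Scope classical_set_scope.
Local Open Scope card_scope.
Local Open Scope ring_scope.

(* The library norm on 'rV[R]_n is the sup norm, hence an explicit l2 formula. *)
Definition eucl_dist (R : realType) (n : nat) (x y : 'rV[R]_n) : R :=
  Num.sqrt (\sum_(m < n) (x 0 m - y 0 m) ^+ 2).

Definition dist_set (R : realType) (n : nat) (A : set 'rV[R]_n) : set R :=
  [set eucl_dist q.1 q.2 | q in [set q | [/\ A q.1, A q.2 & q.1 <> q.2]]].

(* A itself may be infinite a priori. *)
Definition s_distance_set (R : realType) (n s : nat) (A : set 'rV[R]_n) : Prop :=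
  dist_set A #<= `I_s.

Definition eucl_sphere (R : realType) (n : nat) (a : 'rV[R]_n) (r : R) :
    set 'rV[R]_n :=
  [set x | \sum_(m < n) (x 0 m - a 0 m) ^+ 2 = r ^+ 2].

(* Main.v *)
(** If a function [w] on a finite subset [X] of [A] is orthogonal to all
    polynomials of degree at most [s], and [F x y] is the product of the
    [|x - y|^2 - d^2] over the at most [s] distances [d], then
    [sum_(x, y) w x * w y * F x y = 0], since each monomial of [F] has degree at
    most [s] in [x] or in [y].  But [F] is a nonzero constant on the diagonal of
    [X] and vanishes off it, so [w = 0]: polynomials of degree at most [s] span
    the functions on [X].  On a union of [p] spheres, the product of the sphere
    equations is monic of degree [2 p] in the first coordinate, so the monomials
    with exponent less than [2 p] in that coordinate already span, and there are
    as many of them as the bound says. *)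
Require Import Defs.
From mathcomp Require Import all_boot all_order all_algebra.
From mathcomp Require Import all_classical all_reals.
From mathcomp Require Import zify ring.
Local Open Scope classical_set_scope.
Local Open Scope card_scope.
Local Open Scope ring_scope.

Set Implicit Arguments.
Unset Strict Implicit.
Unset Printing Implicit Defensive.
Import Order.TTheory GRing.Theory Num.Theory.

(** This reduces the bound to finite duplicate-free lists in [A]: an infinite [A] would contain a
    finite set with [N.+1] elements. *)
Lemma card_le_uniq (T : choiceType) (A : set T) (N : nat) :
  (forall u : seq T, uniq u -> (forall x, x \in u -> A x) -> (size u <= N)%N) ->
  A #<= `I_N.
Proof.
move=> bound.
have [/finite_setP[k Ak]|/(infinite_set_fset N.+1)[B BA sB]] :=
  pselect (finite_set A).
  rewrite (card_le_eql Ak) card_le_II -(card_fset_set Ak); apply: bound => // x.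
  by rewrite in_fset_set ?inE //; apply/finite_setP; exists k.
have := leq_trans sB (bound _ (finmap.fset_uniq B) (fun x xB => BA x xB)).
by rewrite ltnn.
Qed.

(** * Polynomial functions as spans of monomials *)

Section Polynomials.
Variables (R : comNzRingType) (I : finType).
Implicit Types (f g : (I -> R) -> R) (al be : {ffun I -> nat}).

Definition monomial al (z : I -> R) : R := \prod_i z i ^+ al i.

Definition mon_deg al : nat := \sum_i al i.

(** A polynomial is a function with a finite expansion into monomials, so that bounds on total
    degree and on the degree in one coordinate are both conditions [W] on exponents. *)
Definition polyspan (W : pred {ffun I -> nat}) f : Prop :=
  exists2 t : seq (R * {ffun I -> nat}), all (fun u => W u.2) t &
    forall z, f z = \sum_(u <- t) u.1 * monomial u.2 z.

Definition mon_add al be : {ffun I -> nat} := [ffun i => al i + be i]%N.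

Lemma monomialD al be z :
  monomial (mon_add al be) z = monomial al z * monomial be z.
Proof.
by rewrite /monomial -big_split; apply: eq_bigr => i _; rewrite ffunE exprD.
Qed.

Lemma mon_degD al be : mon_deg (mon_add al be) = (mon_deg al + mon_deg be)%N.
Proof. by rewrite /mon_deg -big_split; apply: eq_bigr => i _; rewrite ffunE. Qed.

Lemma polyspan_monomial (W : pred {ffun I -> nat}) al :
  W al -> polyspan W (monomial al).
Proof.
move=> Wal; exists [:: (1, al)]; first by rewrite /= Wal.
by move=> z; rewrite big_seq1 mul1r.
Qed.

Lemma polyspan0 W : polyspan W (fun=> 0).
Proof. by exists [::] => // z; rewrite big_nil. Qed.

Lemma polyspanD W f g :
  polyspan W f -> polyspan W g -> polyspan W (fun z => f z + g z).
Proof.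
move=> [t Wt ft] [u Wu gu]; exists (t ++ u); first by rewrite all_cat Wt.
by move=> z; rewrite big_cat ft gu.
Qed.

Lemma polyspan_sum W (J : Type) (r : seq J) (P : pred J)
    (F : J -> (I -> R) -> R) :
  (forall j, P j -> polyspan W (F j)) ->
  polyspan W (fun z => \sum_(j <- r | P j) F j z).
Proof.
move=> WF; elim: r => [|j r [t Wt IHt]].
  by exists [::] => // z; rewrite !big_nil.
have [Pj|nPj] := boolP (P j); last first.
  by exists t => // z; rewrite big_cons (negbTE nPj) IHt.
have [u Wu uE] := WF j Pj; exists (u ++ t); first by rewrite all_cat Wu.
by move=> z; rewrite big_cons Pj big_cat -IHt -uE.
Qed.

Lemma polyspanM (W1 W2 W : pred {ffun I -> nat}) f g :
  (forall al be, W1 al -> W2 be -> W (mon_add al be)) ->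
  polyspan W1 f -> polyspan W2 g -> polyspan W (fun z => f z * g z).
Proof.
move=> W12 [t Wt ft] [u Wu gu].
exists [seq (a.1 * b.1, mon_add a.2 b.2) | a <- t, b <- u].
  apply/all_allpairsP => a b ta ub.
  by apply: W12; [apply: (allP Wt)|apply: (allP Wu)].
move=> z; rewrite ft gu big_allpairs_dep mulr_suml; apply: eq_bigr => a _.
by rewrite mulr_sumr; apply: eq_bigr => b _; rewrite monomialD /= mulrACA.
Qed.

Lemma polyspan_const (W : pred {ffun I -> nat}) c :
  W [ffun=> 0%N] -> polyspan W (fun=> c).
Proof.
move=> W0; exists [:: (c, [ffun=> 0%N])]; first by rewrite /= W0.
move=> z; rewrite big_seq1 /monomial big1 ?mulr1 // => i _.
by rewrite ffunE expr0.
Qed.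

Definition mon_unit (i : I) : {ffun I -> nat} := [ffun j => (i == j) : nat].

Lemma mon_deg_unit i : mon_deg (mon_unit i) = 1%N.
Proof.
rewrite /mon_deg (bigD1 i) //= ffunE eqxx big1 // => j ji.
by rewrite ffunE eq_sym (negbTE ji).
Qed.

Lemma monomial_unit i z : monomial (mon_unit i) z = z i.
Proof.
rewrite /monomial (bigD1 i) //= ffunE eqxx expr1 big1 ?mulr1 // => j ji.
by rewrite ffunE eq_sym (negbTE ji) expr0.
Qed.

Lemma polyspan_var (W : pred {ffun I -> nat}) i :
  W (mon_unit i) -> polyspan W (fun z => z i).
Proof.
move=> /polyspan_monomial[t Wt E]; exists t => // z.
by rewrite -E monomial_unit.
Qed.

Lemma polyspanZ W c f : polyspan W f -> polyspan W (fun z => c * f z).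
Proof.
apply: (@polyspanM (pred1 [ffun=> 0%N])) (polyspan_const _ _);
  last exact: eqxx.
move=> al be /eqP-> Wbe; suff -> : mon_add [ffun=> 0%N] be = be by [].
by apply/ffunP => i; rewrite !ffunE.
Qed.

Lemma polyspanB W f g :
  polyspan W f -> polyspan W g -> polyspan W (fun z => f z - g z).
Proof.
move=> Wf /(polyspanZ (-1)) Wg; have [t Wt E] := polyspanD Wf Wg.
by exists t => // z; rewrite -E mulN1r.
Qed.

Lemma polyspan_sum0 (J : finType) (w : J -> R) (x : J -> I -> R) W f :
  polyspan W f ->
  (forall al, W al -> \sum_j w j * monomial al (x j) = 0) ->
  \sum_j w j * f (x j) = 0.
Proof.
move=> [t Wt ft] W0.
under eq_bigr do rewrite ft mulr_sumr.
rewrite exchange_big /= big_seq big1 // => u /(allP Wt) /W0 Wu.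
by under eq_bigr do rewrite mulrCA; rewrite -mulr_sumr Wu mulr0.
Qed.

Definition deg_le d al : bool := (mon_deg al <= d)%N.
Arguments deg_le d al /.

Lemma mon_deg0 : mon_deg [ffun=> 0%N] = 0%N.
Proof. by rewrite /mon_deg big1 // => i _; rewrite ffunE. Qed.

Lemma polyspan_degM d e f g :
  polyspan (deg_le d) f -> polyspan (deg_le e) g ->
  polyspan (deg_le (d + e)) (fun z => f z * g z).
Proof. by apply: polyspanM => al be; rewrite /= mon_degD; apply: leq_add. Qed.

(** * Reduction of one coordinate modulo the sphere equations *)

Variable i0 : I.

Definition deg_red d k al : bool := (mon_deg al <= d)%N && (al i0 < k)%N.
Arguments deg_red d k al /.

(** Exponents of [i0] at most [k - 1] and [l - 1] add up to at most [k + l - 2], which must stay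
    below [m]. *)
Lemma polyspan_redM d e m k l f g : (k + l <= m.+1)%N ->
  polyspan (deg_red d k) f -> polyspan (deg_red e l) g ->
  polyspan (deg_red (d + e) m) (fun z => f z * g z).
Proof.
move=> klm; apply: polyspanM => al be /andP[? ?] /andP[? ?].
by rewrite /= mon_degD ffunE; lia.
Qed.

Lemma polyspan_red_sphere (c : I -> R) b :
  exists2 q, polyspan (deg_red 2 2) q &
    forall z, \sum_i (z i - c i) ^+ 2 - b = z i0 ^+ 2 + q z.
Proof.
(* Only the square at [i0] contributes [z i0 ^+ 2]; what remains of that square is linear in [z i0],
   and the other squares do not involve it. *)
exists (fun z => \sum_(i | i != i0) (z i - c i) * (z i - c i) +
   (- (c i0 *+ 2) * z i0 + (c i0 ^+ 2 - b))).
  apply: polyspanD.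
    apply: polyspan_sum => i ii0; apply: (@polyspan_redM 1 1 _ 1 1) => //;
    (apply: polyspanB; [apply: polyspan_var|apply: polyspan_const]);
    by rewrite /= ?mon_deg_unit ?mon_deg0 ffunE ?(negbTE ii0).
  apply: polyspanD.
    by apply/polyspanZ/polyspan_var; rewrite /= mon_deg_unit ffunE eqxx.
  by apply: polyspan_const; rewrite /= mon_deg0 ffunE.
move=> z; rewrite (bigD1 i0) //=.
by under [in RHS]eq_bigr do rewrite -expr2; ring.
Qed.

Lemma polyspan_red_pow d k :
  (k <= d)%N -> polyspan (deg_red d k.+1) (fun z => z i0 ^+ k).
Proof.
elim: k d => [|k IHk] d kd.
  by apply: polyspan_const; rewrite /= mon_deg0 ffunE.
case: d kd => // d kd; rewrite -add1n.
have -> : (fun z : I -> R => z i0 ^+ (1 + k)) = (fun z => z i0 * z i0 ^+ k).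
  by apply/funext => z; rewrite exprS.
apply: (@polyspan_redM 1 d _ 2 k.+1) => //; last exact: IHk.
by apply: polyspan_var; rewrite /= mon_deg_unit ffunE eqxx.
Qed.

Lemma polyspan_red_prod (J : Type) (r : seq J) (c : J -> I -> R) (b : J -> R) :
  exists2 h, polyspan (deg_red (2 * size r) (2 * size r)) h &
    forall z, \prod_(j <- r) (\sum_i (z i - c j i) ^+ 2 - b j) =
              z i0 ^+ (2 * size r) + h z.
Proof.
elim: r => [|j r [h Wh IHh]].
  by exists (fun=> 0); [exact: polyspan0|move=> z; rewrite big_nil addr0].
have [q Wq qE] := polyspan_red_sphere (c j) (b j).
have E : (2 * size (j :: r) = 2 + 2 * size r)%N by rewrite /= mulnS.
(* These are the terms of [(z i0 ^+ 2 + q z) * (z i0 ^+ (2 * size r) + h z)] other than the leading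
   power of [z i0]. *)
exists (fun z => z i0 ^+ 2 * h z + (q z * z i0 ^+ (2 * size r) + q z * h z)).
  rewrite E; apply: polyspanD.
    by apply: (polyspan_redM _ _ Wh); last exact: polyspan_red_pow.
  apply: polyspanD; last by apply: polyspan_redM Wq Wh; lia.
  by apply: (polyspan_redM _ Wq (polyspan_red_pow _)) => //; lia.
move=> z; rewrite big_cons IHh qE E exprD; ring.
Qed.

(** The product of the sphere equations vanishes at every [x j], so there [z i0 ^+ (2 * p)] equals a
    polynomial of total degree at most [2 * p] and smaller degree in [i0]. Substituting it lowers
    the exponent of [i0] without raising the total degree, which gives an induction on that
    exponent. *)
Lemma red_sum0 (J : finType) (w : J -> R) (x : J -> I -> R) p s
    (c : 'I_p -> I -> R) (b : 'I_p -> R) :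
  (forall j, exists k, \sum_i (x j i - c k i) ^+ 2 = b k) ->
  (forall al, deg_red s (2 * p) al -> \sum_j w j * monomial al (x j) = 0) ->
  forall al, deg_le s al -> \sum_j w j * monomial al (x j) = 0.
Proof.
move=> xV w0 al; have [k] := ubnP (al i0); elim: k al => // k IHk al alk als.
have [lt|ge] := ltnP (al i0) (2 * p); first by apply: w0; apply/andP.
pose be : {ffun I -> nat} := [ffun i => al i - (2 * p) * (i == i0)]%N.
pose al0 : {ffun I -> nat} := [ffun i => (2 * p) * (i == i0)]%N.
have alE : al = mon_add al0 be.
  apply/ffunP => i; rewrite !ffunE; case: eqVneq => [->|_]; lia.
have al0E z : monomial al0 z = z i0 ^+ (2 * p).
  rewrite /monomial (bigD1 i0) //= ffunE eqxx muln1 big1 ?mulr1 // => i ii0.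
  by rewrite ffunE (negbTE ii0) muln0 expr0.
have deg0 : mon_deg al0 = (2 * p)%N.
  rewrite /mon_deg (bigD1 i0) //= ffunE eqxx muln1 big1 ?addn0 // => i ii0.
  by rewrite ffunE (negbTE ii0) muln0.
have [h] := polyspan_red_prod (enum 'I_p) c b.
rewrite size_enum_ord => Wh hE.
have hx j : x j i0 ^+ (2 * p) = - h (x j).
  have [l xl] := xV j; apply/eqP; rewrite -addr_eq0 -hE big_enum (bigD1 l) //=.
  by rewrite xl subrr mul0r.
rewrite alE.
rewrite (eq_bigr (fun j => - (w j * (h (x j) * monomial be (x j)))));
    last first => [j _|].
  by rewrite monomialD al0E hx mulNr mulrN.
rewrite sumrN; apply/eqP; rewrite oppr_eq0; apply/eqP.
have Wbe : polyspan (pred1 be) (monomial be) by apply: polyspan_monomial => /=.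
(* Every monomial of [h z * monomial be z] has degree at most [s] and exponent of [i0] below
   [al i0], so the induction hypothesis covers it. *)
apply: (polyspan_sum0 (W := deg_red s (al i0))
         (f := fun z => h z * monomial be z)); last first.
  by move=> ga /andP[gs gk]; apply: IHk => //; apply: leq_trans gk _.
apply: polyspanM Wh Wbe => ga _ /andP[gd gk] /eqP->.
move: als; rewrite alE /= !mon_degD deg0 ffunE => als.
by rewrite !ffunE eqxx; lia.
Qed.

End Polynomials.
Arguments deg_le I d al /.
Arguments deg_red I i0 d k al /.

(** The index type [I + I] holds the coordinates of a pair of points. A monomial splits into one for
    each point, so its double sum is a product of two single sums; as the degrees add up to at most
    [2 * s], one of them is at most [s] and its sum vanishes. *)
Lemma bidegree_sum0 (R : comNzRingType) (I J : finType) (w : J -> R)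
    (x : J -> I -> R) s (f : (I + I -> R) -> R) :
  (forall al, deg_le s al -> \sum_j w j * monomial al (x j) = 0) ->
  polyspan (deg_le (2 * s)) f ->
  \sum_(j : J * J) w j.1 * w j.2 *
     f (fun i => match i with inl i => x j.1 i | inr i => x j.2 i end) = 0.
Proof.
move=> w0 Wf.
apply: (polyspan_sum0 (w := fun j => w j.1 * w j.2)
  (x := fun j i => match i with inl i => x j.1 i | inr i => x j.2 i end)
  Wf) => ga gas.
pose al : {ffun I -> nat} := [ffun i => ga (inl i)].
pose be : {ffun I -> nat} := [ffun i => ga (inr i)].
have gaE (y z : I -> R) :
    monomial ga (fun i => match i with inl i => y i | inr i => z i end) =
    monomial al y * monomial be z.
  by rewrite /monomial big_sumType; congr (_ * _); apply: eq_bigr => i _;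
    rewrite ffunE.
have degE : mon_deg ga = (mon_deg al + mon_deg be)%N.
  by rewrite /mon_deg big_sumType; congr (_ + _)%N; apply: eq_bigr => i _;
    rewrite ffunE.
under eq_bigr do rewrite gaE mulrACA.
rewrite -(pair_bigA _ (fun j k =>
  w j * monomial al (x j) * (w k * monomial be (x k)))) /=.
rewrite -big_distrlr /=.
move: gas; rewrite /= degE => gas.
have [le_al|lt_al] := leqP (mon_deg al) s; first by rewrite w0 ?mul0r.
by rewrite [X in _ * X]w0 ?mulr0 //=; lia.
Qed.

(** * Counting the reduced exponents *)

(* [k] is the exponent of the first coordinate, and [t] lists the others. *)
Definition red_exponents (m p s : nat) : seq {ffun 'I_m.+1 -> nat} :=
  flatten [seq [seq [ffun i : 'I_m.+1 => nth 0%N (k :: map val (val t)) i] |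
                 t <- enum [set t : m.-tuple 'I_(s - k).+1 |
                             (\sum_(i <- t) i <= s - k)%N]%SET]
          | k <- iota 0 (2 * p) & (k <= s)%N].

Lemma size_red_exponents m p s :
  size (red_exponents m p s) =
  (\sum_(0 <= i < 2 * p | i <= s) 'C(m.+1 + s - i - 1, s - i))%N.
Proof.
rewrite size_flatten /shape -map_comp sumnE big_map big_filter.
rewrite /index_iota subn0; apply: eq_bigr => k ks.
(* There are ['C(m + (s - k), m)] tuples of [m] naturals with sum at most [s - k]; the symmetry of
   binomials then gives the stated form. *)
rewrite /= size_map -cardE card_partial_ord_partitions.
have -> : (m.+1 + s - k - 1 = m + (s - k))%N by lia.
by rewrite -bin_sub ?leq_addr // addKn.
Qed.

Lemma mem_red_exponents m p s al :
  deg_red ord0 s (2 * p) al -> al \in red_exponents m p s.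
Proof.
move=> /andP[als alp].
have degE : mon_deg al = (al ord0 + \sum_(i < m) al (lift ord0 i))%N.
  by rewrite /mon_deg big_ord_recl.
have al0s : (al ord0 <= s)%N by lia.
apply/flatten_mapP; exists (al ord0).
  by rewrite mem_filter al0s mem_iota.
have le_al i : (al (lift ord0 i) < (s - al ord0).+1)%N.
  by move: degE; rewrite (bigD1 i) //= => degE; lia.
pose t := [tuple Ordinal (le_al i) | i < m].
apply/mapP; exists t.
  rewrite mem_enum inE big_tuple.
  under eq_bigr do rewrite tnth_mktuple /=.
  by rewrite leq_subRL // -degE.
apply/ffunP => i; rewrite ffunE; case: (unliftP ord0 i) => [j|] -> //=.
rewrite -map_comp (nth_map j) ?size_enum_ord ?add0n ?ltn_ord //=.
by rewrite nth_ord_enum.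
Qed.

(** A homogeneous system with fewer equations than unknowns: the rank of [M] is at most
    [size t < N], so its left kernel is nonzero. *)
Lemma exists_dependency (F : fieldType) (J : eqType) (t : seq J) N
    (f : J -> 'I_N -> F) : (size t < N)%N ->
  exists2 w : 'I_N -> F, exists j, w j != 0 &
    forall a, a \in t -> \sum_j w j * f a j = 0.
Proof.
move=> tN; pose M : 'M[F]_(N, size t) := \matrix_(j, k) f (tnth (in_tuple t) k) j.
have : kermx M != 0.
  rewrite kermx_eq0 /row_free; apply: contraTN tN => /eqP <-.
  by rewrite -leqNgt rank_leq_col.
case/rowV0Pn => v /sub_kermxP vM /rV0Pn[j vj].
exists (v 0); first by exists j.
move=> a /(nthP a)[k kt <-]; have /matrixP/(_ 0 (Ordinal kt)) := vM.
rewrite !mxE => vMk; rewrite -[RHS]vMk; apply: eq_bigr => i _.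
by rewrite mxE (tnth_nth a).
Qed.

(** * Euclidean distances and the product over them *)

Lemma eucl_distE (R : realType) n (x y : 'rV[R]_n) :
  eucl_dist x y ^+ 2 = \sum_m (x 0 m - y 0 m) ^+ 2.
Proof. by rewrite sqr_sqrtr // sumr_ge0 // => m _; rewrite sqr_ge0. Qed.

Lemma eucl_dist_eq0 (R : realType) n (x y : 'rV[R]_n) :
  eucl_dist x y = 0 -> x = y.
Proof.
move=> /(congr1 (fun d => d ^+ 2)); rewrite eucl_distE expr0n /=.
move/eqP; rewrite psumr_eq0 => [/allP xy|m _]; last by rewrite sqr_ge0.
apply/rowP => m; have := xy m (mem_index_enum m).
by rewrite sqrf_eq0 subr_eq0 => /eqP.
Qed.

Lemma polyspan_dist_prod (R : comNzRingType) (I : finType) (D : seq R) s :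
  (size D <= s)%N ->
  polyspan (deg_le (2 * s)) (fun z : I + I -> R =>
     \prod_(d <- D) (\sum_i (z (inl i) - z (inr i)) ^+ 2 - d ^+ 2)).
Proof.
elim: D s => [|d D IHD] s Ds.
  have -> : (fun z : I + I -> R => \prod_(d <- [::])
     (\sum_i (z (inl i) - z (inr i)) ^+ 2 - d ^+ 2)) = (fun=> 1).
    by apply/funext => z; rewrite big_nil.
  by apply: polyspan_const; rewrite /= mon_deg0.
case: s Ds => // s /IHD{}IHD.
under eq_fun do rewrite big_cons.
rewrite mulnS; apply: polyspan_degM IHD; apply: polyspanB; last first.
  by apply: polyspan_const; rewrite /= mon_deg0.
apply: polyspan_sum => i _; under eq_fun do rewrite expr2.
by apply: (@polyspan_degM _ _ 1 1); apply: polyspanB; apply: polyspan_var;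
  rewrite /= mon_deg_unit.
Qed.

(** The condition [i <= s] renders the convention that a binomial with negative lower index is 0:
    for [i > s], truncated subtraction would give ['C(_, 0) = 1]. *)
Theorem corollary1p5 (R : realType) (n p s : nat)
  (n_ge1 : (1 <= n)%N) (p_ge1 : (1 <= p)%N)
  (a : 'I_p -> 'rV[R]_n) (r : 'I_p -> R) (A : set 'rV[R]_n)
  (A_sub : A `<=` \bigcup_(i in [set: 'I_p]) eucl_sphere (a i) (r i))
  (A_dist : s_distance_set s A) :
  A #<= `I_(\sum_(0 <= i < 2 * p | (i <= s)%N) 'C(n + s - i - 1, s - i))%N.
Proof.
(* A successor dimension provides the distinguished coordinate [ord0]. *)
case: n n_ge1 a A A_sub A_dist => // n _ a A A_sub A_dist.
apply: card_le_uniq => u u_uniq uA; rewrite leqNgt -size_red_exponents.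
apply/negP => lt_u.
pose x j := tnth (in_tuple u) j.
have xA j : A (x j) by apply/uA/mem_tnth.
have x_inj : injective x by apply/tuple_uniqP.
have [w [j0 wj0] w0] := exists_dependency (fun al j => monomial al (x j 0)) lt_u.
have {}w0 : forall al, deg_le s al -> \sum_j w j * monomial al (x j 0) = 0.
  apply: (red_sum0 (i0 := ord0) (c := fun k => a k 0)
    (b := fun k => r k ^+ 2)).
    by move=> j; have [k _ xk] := A_sub _ (xA j); exists k.
  by move=> al /mem_red_exponents; apply: w0.
have finD : finite_set (dist_set A) by apply/finite_set_leP; exists s.
pose D : seq R := finmap.enum_fset (fset_set (dist_set A)).
have DE d : (d \in D) = (d \in dist_set A) by rewrite -in_fset_set.
have := bidegree_sum0 w0 (polyspan_dist_prod _ (geq_card_fset_set A_dist)).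
rewrite -/D -(pair_bigA _ (fun j k => w j * w k *
  \prod_(d <- D) (\sum_i (x j 0 i - x k 0 i) ^+ 2 - d ^+ 2))) /=.
(* The value of the product at a pair of equal points; it is nonzero because every [d] in [D] is a
   distance between distinct points. *)
pose c := \prod_(d <- D) (- d ^+ 2) : R.
have c_neq0 : c != 0.
  rewrite prodf_seq_neq0; apply/allP => d.
  rewrite DE inE => -[[y z] /= [_ _ yz] <-].
  by rewrite oppr_eq0 sqrf_eq0; apply/eqP => /eucl_dist_eq0.
(* For [k != j] the factor at the distance from [x j] to [x k] vanishes, so only the diagonal term
   [w j ^+ 2 * c] survives. *)
under eq_bigr => j _.
  rewrite (bigD1 j) //= [X in _ + X]big1 => [|k kj].
    rewrite (_ : \prod_(d <- D) _ = c); last first.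
      apply: eq_bigr => d _; rewrite big1 ?sub0r // => i _.
      by rewrite subrr expr0n.
    rewrite addr0 -expr2; over.
  have dD : eucl_dist (x j) (x k) \in D.
    rewrite DE inE; exists (x j, x k) => //=; split=> //.
    by move=> /x_inj jk; rewrite jk eqxx in kj.
  by rewrite (big_rem _ dD) /= eucl_distE subrr mul0r mulr0.
(* A vanishing sum of squares in an ordered field forces every [w j] to be 0, against
   [w j0 != 0]. *)
rewrite -mulr_suml => /eqP; rewrite mulf_eq0 (negbTE c_neq0) orbF.
rewrite psumr_eq0 => [/allP/(_ j0 (mem_index_enum _))|j _]; last exact: sqr_ge0.
by rewrite sqrf_eq0 (negbTE wj0).
Qed.
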